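(* Let $\tau>0$, $c>0$, $\lambda\in\mathbb{R}$, $T>0$, $a,b>0$, and consider the wave equation with constant time delay $u_{tt}=c^2u_{xx}+\lambda u(x,t-\tau)$ on the spatial interval $(-a,b)$ with prescribed history function and Dirichlet boundary conditions at $x=-a$ and $x=b$. Consider the Neumann-Neumann waveform relaxation (NNWR) error iteration with relaxation parameter $\theta$ for this problem on the two subdomains $\Omega_1=(-a,0)$ and $\Omega_2=(0,b)$, started from an admissible initial interface error $g^0$. Suppose the subdomains are of equal size, i.e. $a=b$. Then: (i) for $0<\theta<1/2$, $\theta\neq 1/4$, the NNWR iteration converges linearly; (ii) for $\theta=1/4$, the NNWR iteration converges in two iterations, for every time window length $T>0$.
   Context: NNWR error iteration. Since the problem is linear, the iteration is written for the error, i.e. with zero history and zero boundary data. Given $g^0:[0,T]\to\mathbb{R}$ (initial error on the interface $\{x=0\}$), for $k=1,2,\dots$ and $i=1,2$ let $e_i^k$ solve the Dirichlet problem $$\partial_{tt}e_i^k-c^2\partial_{xx}e_i^k-\lambda e_i^k(x,t-\tau)=0\text{ in }\Omega_i\times(0,T),$$ $$e_i^k=\partial_te_i^k=0\text{ on }\Omega_i\times[-\tau,0],\quad e_i^k(0,t)=g^{k-1}(t),\ t\in(0,T),$$ with $e_1^k(-a,t)=0$ and $e_2^k(b,t)=0$; then let $\phi_i^k$ solve the Neumann problem $$\partial_{tt}\phi_i^k-c^2\partial_{xx}\phi_i^k-\lambda \phi_i^k(x,t-\tau)=0\text{ in }\Omega_i\times(0,T),$$ $$\phi_i^k=\partial_t\phi_i^k=0\text{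 on }\Omega_i\times[-\tau,0],\quad \phi_1^k(-a,t)=0,\quad \phi_2^k(b,t)=0,$$ $$\partial_x\phi_1^k(0,t)=\partial_xe_1^k(0,t)-\partial_xe_2^k(0,t),\qquad -\partial_x\phi_2^k(0,t)=\partial_xe_1^k(0,t)-\partial_xe_2^k(0,t),\quad t\in(0,T);$$ and update $g^k(t)=g^{k-1}(t)-\theta\left(\phi_1^k(0,t)+\phi_2^k(0,t)\right)$. Regularity conventions. Solutions are classical: continuous on $\overline{\Omega_i}\times[-\tau,T]$ and twice continuously differentiable on $\overline{\Omega_i}\times[0,T]$. An initial interface error $g^0$ is admissible if it is continuous on $[0,T]$ and all iterates $e_i^k,\phi_i^k$ exist as such classical solutions. Convergence. Let $\|g\|=\sup_{t\in[0,T]}|g(t)|$. The iteration converges linearly if, for every admissible $g^0\not\equiv0$, there is $\rho\in(0,1)$ with $g^{k}\not\equiv 0$ for all $k$ and $\lim_{k\to\infty}\|g^{k}\|/\|g^{k-1}\|=\rho$ (so in particular $g^k\to0$). It converges in two iterations if, for every admissible $g^0$, the errors $e_1^k$, $e_2^k$ and $g^k$ vanish identically for all $k\ge2$. *)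

(* Defs.v *)
(* Stdlib real numbers with Coquelicot. *)
From Stdlib Require Import Reals.
From Coquelicot Require Import Coquelicot.
Open Scope R_scope.

(* Functions of space and time are total functions u : R * R -> R, written
   u (x, t); only their values on the relevant space-time cylinder matter.

   Derivatives are relative to a set D, hence one-sided at an end point of an
   interval, so that "C^2 up to the boundary" and the Neumann data on the
   boundary make literal sense. *)
Definition is_derive_in (D : R -> Prop) (f : R -> R) (x l : R) : Prop :=
  D_in f (fun _ => l) D x.

Definition ex_derive_in (D : R -> Prop) (f : R -> R) (x : R) : Prop :=
  exists l : R, is_derive_in D f x l.

(* Meaningful only under [ex_derive_in], at a limit point x of D. *)
Definition derive_in (D : R -> Prop) (f : R -> R) (x : R) : R :=
  iota (is_derive_in D f x).

Definition dx (K : R * R -> Prop) (u : R * R -> R) : R * R -> R :=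
  fun p => derive_in (fun y => K (y, snd p)) (fun y => u (y, snd p)) (fst p).

Definition dt (K : R * R -> Prop) (u : R * R -> R) : R * R -> R :=
  fun p => derive_in (fun s => K (fst p, s)) (fun s => u (fst p, s)) (snd p).

Definition C1_on (K : R * R -> Prop) (u : R * R -> R) : Prop :=
  (forall x t, K (x, t) ->
     ex_derive_in (fun y => K (y, t)) (fun y => u (y, t)) x /\
     ex_derive_in (fun s => K (x, s)) (fun s => u (x, s)) t) /\
  continuous_on K (dx K u) /\ continuous_on K (dt K u).

Definition C2_on (K : R * R -> Prop) (u : R * R -> R) : Prop :=
  C1_on K u /\ C1_on K (dx K u) /\ C1_on K (dt K u).

Definition cylinder (l r s T : R) : R * R -> Prop :=
  fun p => l <= fst p <= r /\ s <= snd p <= T.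

(* Classical solutions, on the space interval (l, r), of the delay wave
   equation with zero history. *)
Record classical_solution (c lam tau T l r : R) (u : R * R -> R) : Prop := {
  sol_continuous : continuous_on (cylinder l r (- tau) T) u;
  sol_C2 : C2_on (cylinder l r 0 T) u;
  sol_equation : forall x t, l < x < r -> 0 < t < T ->
    let K := cylinder l r 0 T in
    dt K (dt K u) (x, t) - c ^ 2 * dx K (dx K u) (x, t)
      - lam * u (x, t - tau) = 0;
  (* The time derivative is relative to [-tau, T]; at t = 0 it therefore also
     constrains the derivative from the right. *)
  sol_history : forall x t, l < x < r -> - tau <= t <= 0 ->
    u (x, t) = 0 /\
    is_derive_in (fun s => - tau <= s <= T) (fun s => u (x, s)) t 0
}.

(* [ig k] is g^k for k >= 0; [ie1 k], [ie2 k], [iphi1 k], [iphi2 k] are the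
   k-th iterates for k >= 1, their value at k = 0 being irrelevant. *)
Record iterates := {
  ig : nat -> R -> R;
  ie1 : nat -> R * R -> R;
  ie2 : nat -> R * R -> R;
  iphi1 : nat -> R * R -> R;
  iphi2 : nat -> R * R -> R
}.

Record NNWR (a b c lam tau T theta : R) (g0 : R -> R) (I : iterates) : Prop := {
  nnwr_init : forall t, 0 <= t <= T -> ig I 0 t = g0 t;
  nnwr_e1 : forall k, (1 <= k)%nat ->
    classical_solution c lam tau T (- a) 0 (ie1 I k);
  nnwr_e2 : forall k, (1 <= k)%nat ->
    classical_solution c lam tau T 0 b (ie2 I k);
  nnwr_phi1 : forall k, (1 <= k)%nat ->
    classical_solution c lam tau T (- a) 0 (iphi1 I k);
  nnwr_phi2 : forall k, (1 <= k)%nat ->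
    classical_solution c lam tau T 0 b (iphi2 I k);
  nnwr_outer : forall k t, (1 <= k)%nat -> 0 < t < T ->
    ie1 I k (- a, t) = 0 /\ ie2 I k (b, t) = 0 /\
    iphi1 I k (- a, t) = 0 /\ iphi2 I k (b, t) = 0;
  nnwr_dirichlet : forall k t, (1 <= k)%nat -> 0 < t < T ->
    ie1 I k (0, t) = ig I (k - 1) t /\ ie2 I k (0, t) = ig I (k - 1) t;
  nnwr_neumann : forall k t, (1 <= k)%nat -> 0 < t < T ->
    let K1 := cylinder (- a) 0 0 T in
    let K2 := cylinder 0 b 0 T in
    let jump := dx K1 (ie1 I k) (0, t) - dx K2 (ie2 I k) (0, t) in
    dx K1 (iphi1 I k) (0, t) = jump /\ - dx K2 (iphi2 I k) (0, t) = jump;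
  nnwr_update : forall k t, (1 <= k)%nat -> 0 <= t <= T ->
    ig I k t =
      ig I (k - 1) t - theta * (iphi1 I k (0, t) + iphi2 I k (0, t))
}.

Definition admissible (a b c lam tau T theta : R) (g0 : R -> R) : Prop :=
  continuous_on (fun t => 0 <= t <= T) g0 /\
  exists I : iterates, NNWR a b c lam tau T theta g0 I.

Definition sup_norm (T : R) (g : R -> R) : R :=
  real (Lub_Rbar (fun y => exists t, 0 <= t <= T /\ y = Rabs (g t))).

Definition not_identically_zero (T : R) (g : R -> R) : Prop :=
  exists t, 0 <= t <= T /\ g t <> 0.

Definition converges_linearly (a b c lam tau T theta : R) : Prop :=
  forall g0 : R -> R,
    admissible a b c lam tau T theta g0 -> not_identically_zero T g0 ->
    exists rho : R, 0 < rho < 1 /\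
      forall I : iterates, NNWR a b c lam tau T theta g0 I ->
        (forall k, not_identically_zero T (ig I k)) /\
        is_lim_seq (fun k => sup_norm T (ig I (S k)) / sup_norm T (ig I k))
          rho.

Definition converges_in_two_iterations (a b c lam tau T theta : R) : Prop :=
  forall g0 : R -> R,
    admissible a b c lam tau T theta g0 ->
    forall I : iterates, NNWR a b c lam tau T theta g0 I ->
      forall k, (2 <= k)%nat ->
        (forall p, cylinder (- a) 0 (- tau) T p -> ie1 I k p = 0) /\
        (forall p, cylinder 0 b (- tau) T p -> ie2 I k p = 0) /\
        (forall t, 0 <= t <= T -> ig I k t = 0).

(* Main.v *)
(* For a = b the reflection x -> -x exchanges the two subdomains, so uniqueness
   gives e_1(-x, t) = e_2(x, t); the flux jump at the interface is then
   2 d_x e_1 = -2 d_x e_2, and uniqueness again gives phi_i = 2 e_i. Hence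
   g^k = (1 - 4 theta) g^(k-1), and rho = |1 - 4 theta|.

   Uniqueness is proved along characteristics: the Riemann invariants
   u_t + c u_x and u_t - c u_x are transported, up to the delay term, and are
   exchanged up to sign by reflection at an end point carrying a Dirichlet or
   Neumann condition. Over a time step of at most min(tau, (r - l) / c) the
   delay term vanishes and there is at most one reflection. *)
Require Import Defs.
From Stdlib Require Import Reals Lra Lia.
From Coquelicot Require Import Coquelicot.
Open Scope R_scope.

(** * Continuity relative to a set, and extension of identities to the boundary *)

Lemma continuous_on_comp {T U V : UniformSpace} (D : T -> Prop) (E : U -> Prop)
  (h : T -> U) (f : U -> V) :
  (forall x, D x -> E (h x)) -> continuous_on D h -> continuous_on E f ->
  continuous_on D (fun x => f (h x)).
Proof.
  intros HDE Hh Hf x Hx.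
  apply (filterlim_comp _ _ _ h f _ (within E (locally (h x)))).
  - intros P HP.
    generalize (Hh x Hx _ HP). unfold filtermap, within.
    apply filter_imp. intros y Hy Dy. apply (Hy Dy), HDE, Dy.
  - apply Hf, HDE, Hx.
Qed.

Lemma continuous_on_lin {T : UniformSpace} (D : T -> Prop) (f g : T -> R)
  (m n : R) :
  continuous_on D f -> continuous_on D g ->
  continuous_on D (fun x => m * f x + n * g x).
Proof.
  intros Hf Hg x Hx.
  apply (filterlim_comp_2 (G := locally (m * f x)) (H := locally (n * g x))
           (fun x => m * f x) (fun x => n * g x) Rplus).
  - apply (filterlim_comp _ _ _ f (Rmult m) _ (locally (f x))).
    + apply Hf, Hx.
    + apply (filterlim_scal_r m (f x)).
  - apply (filterlim_comp _ _ _ g (Rmult n) _ (locally (g x))).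
    + apply Hg, Hx.
    + apply (filterlim_scal_r n (g x)).
  - apply (filterlim_plus (m * f x) (n * g x)).
Qed.

Lemma continuous_pair {T U V : UniformSpace} (f : T -> U) (g : T -> V) (x : T) :
  continuous f x -> continuous g x -> continuous (fun y => (f y, g y)) x.
Proof.
  intros Hf Hg. apply (proj2 (filterlim_locally _ _)). intros eps.
  generalize (filter_and _ _ (proj1 (filterlim_locally _ _) Hf eps)
                (proj1 (filterlim_locally _ _) Hg eps)).
  apply filter_imp. intros y Hy. exact Hy.
Qed.

(* Density along the segment from [p] to an interior point [q]. *)
Lemma continuous_on_eq0_segment (K : R * R -> Prop) (f : R * R -> R)
  (x t y s : R) :
  continuous_on K f -> K (x, t) ->
  (forall e, 0 < e <= 1 ->
     K (x + e * (y - x), t + e * (s - t)) /\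
     f (x + e * (y - x), t + e * (s - t)) = 0) ->
  f (x, t) = 0.
Proof.
  intros Hf HK H.
  set (h := fun e : R => (x + e * (y - x), t + e * (s - t))).
  assert (Hc : continuous_on (fun e => 0 <= e <= 1) (fun e => f (h e))).
  { apply (continuous_on_comp _ K h f).
    - intros e He. destruct (Req_dec e 0) as [->|Hn].
      + unfold h. rewrite !Rmult_0_l, !Rplus_0_r. exact HK.
      + apply H. lra.
    - apply continuous_on_forall. intros e _.
      apply (continuous_pair (fun e => x + e * (y - x))
               (fun e => t + e * (s - t)) e).
      + apply (ex_derive_continuous (fun e => x + e * (y - x))).
        auto_derive; auto.
      + apply (ex_derive_continuous (fun e => t + e * (s - t))).
        auto_derive; auto.
    - exact Hf. }
  assert (H0 : f (h 0) = f (x, t)).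
  { unfold h. rewrite !Rmult_0_l, !Rplus_0_r. reflexivity. }
  destruct (Req_dec (f (x, t)) 0) as [|Hn]; [assumption|exfalso].
  assert (Hp : 0 < Rabs (f (x, t))) by (apply Rabs_pos_lt, Hn).
  assert (H00 : 0 <= 0 <= 1) by lra.
  destruct (proj1 (filterlim_locally _ _) (Hc 0 H00) (mkposreal _ Hp))
    as [d Hd].
  assert (Hm : 0 < Rmin 1 (d / 2)).
  { apply Rmin_pos; [lra|]. generalize (cond_pos d); lra. }
  pose proof (Rmin_l 1 (d / 2)). pose proof (Rmin_r 1 (d / 2)).
  set (e := Rmin 1 (d / 2)) in *.
  assert (He : ball (f (h 0)) (Rabs (f (x, t))) (f (h e))).
  { apply Hd; [|lra].
    change (Rabs (e - 0) < d). rewrite Rabs_pos_eq; generalize (cond_pos d); lra. }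
  change (Rabs (f (h e) - f (h 0)) < Rabs (f (x, t))) in He.
  rewrite H0 in He. unfold h in He. rewrite (proj2 (H e ltac:(lra))) in He.
  rewrite Rabs_minus_sym, Rminus_0_r in He. lra.
Qed.

(** The segment from a point of the closed cylinder to its centre lies, apart from its starting
    point, in the open cylinder. *)
Lemma continuous_on_eq0_cylinder (K : R * R -> Prop) (f : R * R -> R)
  (l r s0 s1 : R) :
  l < r -> s0 < s1 -> continuous_on K f ->
  (forall p, cylinder l r s0 s1 p -> K p) ->
  (forall x t, l < x < r -> s0 < t < s1 -> f (x, t) = 0) ->
  forall x t, l <= x <= r -> s0 <= t <= s1 -> f (x, t) = 0.
Proof.
  intros Hlr Hs Hf HK H x t Hx Ht.
  apply (continuous_on_eq0_segment K f x t ((l + r) / 2) ((s0 + s1) / 2) Hf).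
  - apply HK. split; assumption.
  - intros e He.
    assert (l < x + e * ((l + r) / 2 - x) < r) by nra.
    assert (s0 < t + e * ((s0 + s1) / 2 - t) < s1) by nra.
    split; [apply HK; split; simpl; lra | apply H; assumption].
Qed.

(** * One-dimensional calculus on closed intervals and relative derivatives *)

Lemma clamp_continuous (f : R -> R) (p q : R) :
  p <= q -> continuous_on (fun s => p <= s <= q) f ->
  forall s, continuity_pt (fun s => f (Rmax p (Rmin q s))) s.
Proof.
  intros Hpq Hf s. apply continuity_pt_filterlim.
  apply (continuous_continuous_on (fun _ => True)
           (fun s => f (Rmax p (Rmin q s)))).
  { apply filter_forall; trivial. }
  apply (continuous_on_comp (fun _ => True) (fun s => p <= s <= q)
           (fun s => Rmax p (Rmin q s)) f); [| |exact Hf].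
  - intros y _. unfold Rmax, Rmin.
    destruct (Rle_dec q y); destruct (Rle_dec p _); lra.
  - apply continuous_on_forall. intros y _.
    apply (proj2 (filterlim_locally _ _)). intros eps. exists eps.
    intros z Hz. change (Rabs (z - y) < eps) in Hz.
    change (Rabs (Rmax p (Rmin q z) - Rmax p (Rmin q y)) < eps).
    revert Hz. unfold Rmax, Rmin, Rabs.
    destruct (Rle_dec q z); destruct (Rle_dec q y);
      repeat destruct (Rle_dec p _); repeat destruct (Rcase_abs _); lra.
Qed.

(** The mean value theorem is applied to the clamped extension of [f]. No derivative is asked for at
    [p] and [q], so a characteristic may start or end on the boundary. *)
Lemma is_derive0_eq (f : R -> R) (p q : R) :
  p <= q -> continuous_on (fun s => p <= s <= q) f ->
  (forall s, p < s < q -> is_derive f s 0) -> f q = f p.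
Proof.
  intros Hpq Hc Hd.
  destruct (Rle_lt_or_eq_dec _ _ Hpq) as [Hlt|]; [|congruence].
  assert (Hcl : forall s, p <= s <= q -> f (Rmax p (Rmin q s)) = f s).
  { intros s Hs. rewrite Rmin_right, Rmax_right; lra. }
  destruct (MVT_gen (fun s => f (Rmax p (Rmin q s))) p q (fun _ => 0))
    as [s [_ E]].
  - intros s. rewrite Rmin_left, Rmax_right by lra. intros Hs.
    apply is_derive_ext_loc with (2 := Hd s Hs).
    apply (open_and (fun s => p < s) (fun s => s < q) (open_gt p) (open_lt q))
      in Hs. revert Hs. apply filter_imp. intros y Hy. rewrite Hcl; lra.
  - intros s _. now apply clamp_continuous.
  - rewrite !Hcl in E by lra. lra.
Qed.

Lemma is_derive_in_subset (D E : R -> Prop) (f : R -> R) (x m : R) :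
  (forall y, E y -> D y) -> is_derive_in D f x m -> is_derive_in E f x m.
Proof.
  intros HDE H eps Heps. destruct (H eps Heps) as [d [Hd H']].
  exists d. split; [exact Hd|]. intros y [[Ey Hy] Hyd].
  apply H'. repeat split; auto.
Qed.

Lemma is_derive_in_unique (D : R -> Prop) (f : R -> R) (p q x m n : R) :
  p < q -> p <= x <= q -> (forall y, p <= y <= q -> D y) ->
  is_derive_in D f x m -> is_derive_in D f x n -> m = n.
Proof.
  intros Hpq Hx HD Hm Hn.
  refine (single_limit _ _ _ _ x _ Hm Hn). intros d Hd.
  (* A step of length [e] towards the farther end point stays in [[p, q]], hence in [D], so [x] is a
     limit point of [D]. *)
  set (e := Rmin (d / 2) ((q - p) / 2)).
  assert (0 < e) by (apply Rmin_pos; lra).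
  assert (e <= d / 2 /\ e <= (q - p) / 2) by (split; [apply Rmin_l|apply Rmin_r]).
  unfold Rdist.
  destruct (Rle_dec x ((p + q) / 2)).
  - exists (x + e). split; [split; [apply HD|]; lra|].
    rewrite Rabs_pos_eq; lra.
  - exists (x - e). split; [split; [apply HD|]; lra|].
    rewrite Rabs_left; lra.
Qed.

Lemma derive_in_correct (D : R -> Prop) (f : R -> R) (p q x : R) :
  p < q -> p <= x <= q -> (forall y, p <= y <= q -> D y) ->
  ex_derive_in D f x -> is_derive_in D f x (derive_in D f x).
Proof.
  intros Hpq Hx HD [m Hm].
  assert (E : derive_in D f x = m).
  { apply (iota_unique (is_derive_in D f x)); [|exact Hm].
    intros n Hn. now apply (is_derive_in_unique D f p q x). }
  now rewrite E.
Qed.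

Lemma is_derive_in_is_derive (D : R -> Prop) (f : R -> R) (p q x m : R) :
  p < x < q -> (forall y, p <= y <= q -> D y) ->
  is_derive_in D f x m -> is_derive f x m.
Proof.
  intros Hx HD H. apply is_derive_Reals. intros eps Heps.
  destruct (H eps Heps) as [d [Hd H']].
  assert (Hm : 0 < Rmin d (Rmin (x - p) (q - x))).
  { repeat apply Rmin_pos; lra. }
  exists (mkposreal _ Hm). intros h Hh0 Hh. simpl in Hh.
  pose proof (Rmin_l d (Rmin (x - p) (q - x))).
  pose proof (Rmin_r d (Rmin (x - p) (q - x))).
  pose proof (Rmin_l (x - p) (q - x)).
  pose proof (Rmin_r (x - p) (q - x)).
  apply Rabs_def2 in Hh.
  specialize (H' (x + h)). simpl in H'. unfold Rdist in H'.
  replace (x + h - x) with h in H' by ring.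
  apply H'. split; [split; [apply HD; lra|lra]|].
  apply Rabs_def1; lra.
Qed.

Lemma is_derive_zero (f : R -> R) (p q x m : R) :
  p < x < q -> (forall y, p < y < q -> f y = 0) -> is_derive f x m -> m = 0.
Proof.
  intros Hx Hf H. apply is_derive_unique in H. rewrite <- H.
  rewrite <- (Derive_const 0 x). apply Derive_ext_loc.
  apply (open_and (fun s => p < s) (fun s => s < q) (open_gt p) (open_lt q))
    in Hx. revert Hx. apply filter_imp. exact Hf.
Qed.

(** * Uniqueness along characteristics *)

(* [p] and [q] stand for u_t and u_x. The wave equation enters through
   [rs_characteristic], as the transport of the Riemann invariants
   u_t + e c u_x, e = 1 or -1, along the backward characteristics. *)
Record riemann_solution (c lam tau T l r : R) (u p q : R * R -> R) : Prop := {
  rs_continuous_u : continuous_on (cylinder l r (- tau) T) u;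
  rs_continuous_p : continuous_on (cylinder l r 0 T) p;
  rs_continuous_q : continuous_on (cylinder l r 0 T) q;
  rs_derive_t : forall x t, l <= x <= r -> 0 < t < T ->
    is_derive (fun s => u (x, s)) t (p (x, t));
  rs_characteristic : forall e x t s, e = 1 \/ e = - 1 ->
    l < x + e * c * s < r -> 0 < t - s < T ->
    is_derive (fun s => 1 * p (x + e * c * s, t - s) +
                        e * c * q (x + e * c * s, t - s))
      s (- lam * u (x + e * c * s, t - s - tau));
  rs_initial : forall x, l < x < r ->
    p (x, 0) = 0 /\ q (x, 0) = 0 /\
    forall t, - tau <= t <= 0 -> u (x, t) = 0
}.

Arguments rs_continuous_u {c lam tau T l r u p q}.
Arguments rs_continuous_p {c lam tau T l r u p q}.
Arguments rs_continuous_q {c lam tau T l r u p q}.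
Arguments rs_derive_t {c lam tau T l r u p q}.
Arguments rs_characteristic {c lam tau T l r u p q}.
Arguments rs_initial {c lam tau T l r u p q}.

(** The time [s] may exceed [T], so steps of a fixed length can be iterated without a special last
    step. *)
Definition zero_before (l r T s : R) (u p q : R * R -> R) : Prop :=
  forall x t, l <= x <= r -> 0 <= t <= T -> t <= s ->
    u (x, t) = 0 /\ p (x, t) = 0 /\ q (x, t) = 0.

Section Uniqueness.

Variables (c lam tau T l r : R) (u p q : R * R -> R).
Hypotheses (hc : 0 < c) (htau : 0 < tau) (hT : 0 < T) (hlr : l < r).
Hypothesis sol : riemann_solution c lam tau T l r u p q.

Lemma zero_history (x t : R) :
  l <= x <= r -> - tau <= t <= 0 -> u (x, t) = 0.
Proof.
  intros Hx Ht.
  apply (continuous_on_eq0_segment (cylinder l r (- tau) T) u x t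
           ((l + r) / 2) t (rs_continuous_u sol)).
  - split; simpl; lra.
  - intros e He. assert (l < x + e * ((l + r) / 2 - x) < r) by nra.
    replace (t + e * (t - t)) with t by ring.
    split; [split; simpl; lra|].
    now apply (rs_initial sol).
Qed.

Lemma zero_before_0 : zero_before l r T 0 u p q.
Proof.
  intros x t Hx Ht Ht0. replace t with 0 by lra.
  split; [apply zero_history; lra|].
  assert (H : forall f, continuous_on (cylinder l r 0 T) f ->
            (forall y, l < y < r -> f (y, 0) = 0) -> f (x, 0) = 0).
  { intros f Hf Hf0.
    apply (continuous_on_eq0_segment (cylinder l r 0 T) f x 0
             ((l + r) / 2) 0 Hf); [split; simpl; lra|].
    intros e He. assert (l < x + e * ((l + r) / 2 - x) < r) by nra.
    replace (0 + e * (0 - 0)) with 0 by ring.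
    split; [split; simpl; lra|]. now apply Hf0. }
  split; apply H; try apply (rs_continuous_p sol);
    try apply (rs_continuous_q sol);
    intros y Hy; now apply (rs_initial sol).
Qed.

(** The derivative along the characteristic is a multiple of [u] at a time delayed by [tau]. Since
    [t <= s + tau], that time is at most [s], where [u] already vanishes. *)
Lemma characteristic_constant (s e x t d : R) :
  zero_before l r T s u p q -> 0 <= s -> e = 1 \/ e = - 1 ->
  l <= x <= r -> l <= x + e * c * d <= r -> 0 <= d -> s <= t - d ->
  t < T -> t <= s + tau ->
  p (x, t) + e * c * q (x, t) =
  p (x + e * c * d, t - d) + e * c * q (x + e * c * d, t - d).
Proof.
  intros Hz Hs He Hx Hxd Hd Hsd HtT Htau.
  (* Both ends of the characteristic may lie on the lateral boundary; as [e * c] is nonzero, the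
     points between them are strictly inside, where the transport equation holds. *)
  assert (Hin : forall y, 0 < y < d -> l < x + e * c * y < r).
  { intros y Hy. assert (0 < c * y < c * d) by nra.
    destruct He as [-> | ->]; nra. }
  assert (Hin' : forall y, 0 <= y <= d -> l <= x + e * c * y <= r).
  { intros y Hy. assert (0 <= c * y <= c * d) by nra.
    destruct He as [-> | ->]; nra. }
  set (g := fun y => 1 * p (x + e * c * y, t - y) +
                     e * c * q (x + e * c * y, t - y)).
  assert (Hh : continuous_on (fun y : R => 0 <= y <= d)
                 (fun y : R => (x + e * c * y, t - y))).
  { apply continuous_on_forall. intros y _.
    apply (continuous_pair (fun y => x + e * c * y) (fun y => t - y)).
    - apply (ex_derive_continuous (fun y => x + e * c * y)).
      auto_derive; auto.
    - apply (ex_derive_continuous (fun y => t - y)). auto_derive; auto. }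
  assert (Hg : g d = g 0).
  { apply is_derive0_eq; [exact Hd| |].
    - apply continuous_on_lin;
        apply (continuous_on_comp _ (cylinder l r 0 T)
                 (fun y => (x + e * c * y, t - y))); auto;
        try apply (rs_continuous_p sol);
        try apply (rs_continuous_q sol);
        intros y Hy; (split; simpl; [now apply Hin'|lra]).
    - intros y Hy.
      assert (Hu : u (x + e * c * y, t - y - tau) = 0).
      { destruct (Rle_dec (t - y - tau) 0).
        - apply zero_history; [apply Hin'|]; lra.
        - apply Hz; [apply Hin'| |]; lra. }
      pose proof (rs_characteristic sol e x t y He
                    (Hin y Hy) ltac:(lra)) as Hder.
      rewrite Hu, Rmult_0_r in Hder. exact Hder. }
  unfold g in Hg. rewrite Rmult_0_r, Rplus_0_r, Rminus_0_r in Hg. lra.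
Qed.

(** A homogeneous Dirichlet condition gives [p = 0] by differentiation in time, a homogeneous
    Neumann condition is [q = 0]. The type of condition may differ between the two ends. *)
Hypothesis boundary : forall t, 0 < t < T ->
  (p (l, t) = 0 \/ q (l, t) = 0) /\ (p (r, t) = 0 \/ q (r, t) = 0).

(* The backward characteristic meets the boundary at most once before time s,
   and the boundary condition there turns one Riemann invariant into plus or
   minus the other one. *)
Lemma riemann_invariant_zero (s e x t : R) :
  zero_before l r T s u p q -> 0 <= s -> e = 1 \/ e = - 1 ->
  l <= x <= r -> s < t < T -> t <= s + tau -> c * (t - s) <= r - l ->
  p (x, t) + e * c * q (x, t) = 0.
Proof.
  intros Hz Hs He Hx Ht Htau Hstep.
  (* The case without reflection, stated for all [e], [x], [t] so that it also serves for the
     characteristic after a reflection. *)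
  assert (foot : forall e x t, e = 1 \/ e = - 1 -> l <= x <= r ->
            s < t < T -> t <= s + tau -> l <= x + e * c * (t - s) <= r ->
            p (x, t) + e * c * q (x, t) = 0).
  { clear e x t He Hx Ht Htau Hstep. intros e x t He Hx Ht Htau Hy.
    rewrite (characteristic_constant s e x t (t - s)) by (trivial; lra).
    destruct (Hz (x + e * c * (t - s)) (t - (t - s)) Hy ltac:(lra) ltac:(lra))
      as [_ [-> ->]]. ring. }
  assert (Hcs : 0 < c * (t - s)) by nra.
  destruct (Rle_dec (x + e * c * (t - s)) r);
    [destruct (Rle_dec l (x + e * c * (t - s)))|].
  - apply foot; auto.
  - assert (e = - 1) as -> by (destruct He; [subst e; lra|assumption]).
    (* The backward characteristic leaves through the left end; [d] is the time it takes to get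
       there. *)
    set (d := (x - l) / c).
    assert (Hcd : c * d = x - l) by (unfold d; field; lra).
    assert (Hd : 0 <= d < t - s).
    { split; [apply Rdiv_le_0_compat; lra|]. apply Rmult_lt_reg_l with c; lra. }
    rewrite (characteristic_constant s (- 1) x t d) by (trivial; lra).
    replace (x + - 1 * c * d) with l by lra.
    (* The reflected characteristic cannot reach the other end before time [s], because
       [c * (t - s) <= r - l]. *)
    assert (H : p (l, t - d) + 1 * c * q (l, t - d) = 0).
    { apply foot; auto; lra. }
    destruct (proj1 (boundary (t - d) ltac:(lra))) as [E|E];
      rewrite E in *; lra.
  - assert (e = 1) as -> by (destruct He; [assumption|subst e; lra]).
    set (d := (r - x) / c).
    assert (Hcd : c * d = r - x) by (unfold d; field; lra).
    assert (Hd : 0 <= d < t - s).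
    { split; [apply Rdiv_le_0_compat; lra|]. apply Rmult_lt_reg_l with c; lra. }
    rewrite (characteristic_constant s 1 x t d) by (trivial; lra).
    replace (x + 1 * c * d) with r by lra.
    assert (H : p (r, t - d) + - 1 * c * q (r, t - d) = 0).
    { apply foot; auto; lra. }
    destruct (proj2 (boundary (t - d) ltac:(lra))) as [E|E];
      rewrite E in *; lra.
Qed.

(** In the open strip above time [s] both Riemann invariants vanish, hence [p] and [q]; then [u] is
    constant in time from its value 0 at [s]. Continuity covers the upper edge, including the final
    time [T], at which no equation is imposed. *)
Lemma zero_before_step (s h : R) :
  zero_before l r T s u p q -> 0 <= s -> 0 < h <= tau -> c * h <= r - l ->
  zero_before l r T (s + h) u p q.
Proof.
  intros Hz Hs Hh Hch.
  destruct (Rle_dec T s) as [HTs|HTs].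
  { intros x t Hx Ht _. apply Hz; lra. }
  set (s' := Rmin T (s + h)).
  assert (Hs'T : s' <= T) by apply Rmin_l.
  assert (Hs'h : s' <= s + h) by apply Rmin_r.
  assert (Hss' : s < s') by (apply Rmin_glb_lt; lra).
  assert (Hpq : forall x t, l <= x <= r -> s < t < s' ->
            p (x, t) = 0 /\ q (x, t) = 0).
  { intros x t Hx Ht.
    assert (Hcts : c * (t - s) <= r - l) by nra.
    pose proof (riemann_invariant_zero s 1 x t Hz Hs (or_introl eq_refl) Hx
                  ltac:(lra) ltac:(lra) Hcts).
    pose proof (riemann_invariant_zero s (- 1) x t Hz Hs (or_intror eq_refl) Hx
                  ltac:(lra) ltac:(lra) Hcts).
    split; [lra|]. apply Rmult_eq_reg_l with c; lra. }
  assert (Hu : forall x t, l <= x <= r -> s < t < s' -> u (x, t) = 0).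
  { intros x t Hx Ht.
    rewrite (is_derive0_eq (fun y => u (x, y)) s t); [| lra | |].
    - now apply Hz; try lra.
    - apply (continuous_on_comp _ (cylinder l r (- tau) T) (fun y => (x, y)) u).
      + intros y Hy. split; simpl; lra.
      + apply continuous_on_forall. intros y _.
        apply (continuous_pair (fun _ => x) (fun y => y));
          [apply continuous_const|apply continuous_id].
      + apply (rs_continuous_u sol).
    - intros y Hy. rewrite <- (proj1 (Hpq x y Hx ltac:(lra))).
      apply (rs_derive_t sol); lra. }
  intros x t Hx Ht Hth.
  destruct (Rle_dec t s) as [Hts|Hts]; [now apply Hz|].
  assert (Hts' : s <= t <= s').
  { split; [lra|]. apply Rmin_glb; lra. }
  repeat split.
  - apply (continuous_on_eq0_cylinder (cylinder l r (- tau) T) u l r s s');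
      trivial.
    + apply (rs_continuous_u sol).
    + intros [y z] [Hy Hz']. simpl in Hy, Hz'. split; simpl; lra.
    + intros y z Hy Hz'. apply Hu; lra.
  - apply (continuous_on_eq0_cylinder (cylinder l r 0 T) p l r s s'); trivial.
    + apply (rs_continuous_p sol).
    + intros [y z] [Hy Hz']. simpl in Hy, Hz'. split; simpl; lra.
    + intros y z Hy Hz'. apply Hpq; lra.
  - apply (continuous_on_eq0_cylinder (cylinder l r 0 T) q l r s s'); trivial.
    + apply (rs_continuous_q sol).
    + intros [y z] [Hy Hz']. simpl in Hy, Hz'. split; simpl; lra.
    + intros y z Hy Hz'. apply Hpq; lra.
Qed.

Lemma riemann_solution_zero_pointwise :
  (forall x t, cylinder l r (- tau) T (x, t) -> u (x, t) = 0) /\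
  (forall x t, cylinder l r 0 T (x, t) -> q (x, t) = 0).
Proof.
  (* The smaller of the delay and the time a wave needs to cross the interval. *)
  set (h := Rmin tau ((r - l) / c)).
  assert (Hh : 0 < h).
  { apply Rmin_pos; [lra|]. apply Rdiv_lt_0_compat; lra. }
  assert (Hht : h <= tau) by apply Rmin_l.
  assert (Hch : c * h <= r - l).
  { replace (r - l) with (c * ((r - l) / c)) by (field; lra).
    apply Rmult_le_compat_l; [lra|]. apply Rmin_r. }
  assert (Hn : forall n, zero_before l r T (INR n * h) u p q).
  { induction n as [|n IH].
    - simpl. rewrite Rmult_0_l. exact zero_before_0.
    - rewrite S_INR, Rmult_plus_distr_r, Rmult_1_l.
      apply zero_before_step; auto.
      apply Rmult_le_pos; [apply pos_INR|lra]. }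
  destruct (INR_archimed h T Hh) as [n HnT].
  split; intros x t [Hx Ht]; simpl in Hx, Ht.
  - destruct (Rle_dec t 0); [apply zero_history; lra|].
    apply (Hn n); lra.
  - apply (Hn n); lra.
Qed.

End Uniqueness.

Lemma riemann_solution_zero (c lam tau T l r : R) (u p q : R * R -> R) :
  0 < c -> 0 < tau -> 0 < T -> l < r ->
  riemann_solution c lam tau T l r u p q ->
  (forall t, 0 < t < T -> u (l, t) = 0) \/
  (forall t, 0 < t < T -> q (l, t) = 0) ->
  (forall t, 0 < t < T -> u (r, t) = 0) \/
  (forall t, 0 < t < T -> q (r, t) = 0) ->
  (forall x t, cylinder l r (- tau) T (x, t) -> u (x, t) = 0) /\
  (forall x t, cylinder l r 0 T (x, t) -> q (x, t) = 0).
Proof.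
  intros hc htau hT hlr sol Hl Hr.
  assert (Hp : forall x, l <= x <= r ->
            (forall t, 0 < t < T -> u (x, t) = 0) \/
            (forall t, 0 < t < T -> q (x, t) = 0) ->
            forall t, 0 < t < T -> p (x, t) = 0 \/ q (x, t) = 0).
  { intros x Hx [H|H] t Ht; [left|right; now apply H].
    apply (is_derive_zero (fun s => u (x, s)) 0 T t); trivial.
    apply (rs_derive_t sol); trivial. }
  apply (riemann_solution_zero_pointwise c lam tau T l r u p q); trivial.
  intros t Ht. split; apply Hp; trivial; lra.
Qed.

(** * From classical solutions to Riemann invariants *)

Lemma dx_correct (l r s T x t : R) (u : R * R -> R) :
  l < r -> C1_on (cylinder l r s T) u -> cylinder l r s T (x, t) ->
  is_derive_in (fun y => cylinder l r s T (y, t)) (fun y => u (y, t)) x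
    (dx (cylinder l r s T) u (x, t)).
Proof.
  intros Hlr [H _] HK.
  apply (derive_in_correct _ _ l r x); trivial.
  - apply HK.
  - intros y Hy. split; [exact Hy|apply HK].
  - now apply H.
Qed.

Lemma dt_correct (l r s T x t : R) (u : R * R -> R) :
  s < T -> C1_on (cylinder l r s T) u -> cylinder l r s T (x, t) ->
  is_derive_in (fun y => cylinder l r s T (x, y)) (fun y => u (x, y)) t
    (dt (cylinder l r s T) u (x, t)).
Proof.
  intros HsT [H _] HK.
  apply (derive_in_correct _ _ s T t); trivial.
  - apply HK.
  - intros y Hy. split; [apply HK|exact Hy].
  - now apply H.
Qed.

Lemma is_derive_dx (l r s T x t : R) (u : R * R -> R) :
  C1_on (cylinder l r s T) u -> l < x < r -> s <= t <= T ->
  is_derive (fun y => u (y, t)) x (dx (cylinder l r s T) u (x, t)).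
Proof.
  intros H Hx Ht.
  apply (is_derive_in_is_derive (fun y => cylinder l r s T (y, t)) _ l r);
    trivial.
  - intros y Hy. split; assumption.
  - apply dx_correct; [lra|trivial|split; simpl; lra].
Qed.

Lemma is_derive_dt (l r s T x t : R) (u : R * R -> R) :
  C1_on (cylinder l r s T) u -> l <= x <= r -> s < t < T ->
  is_derive (fun y => u (x, y)) t (dt (cylinder l r s T) u (x, t)).
Proof.
  intros H Hx Ht.
  apply (is_derive_in_is_derive (fun y => cylinder l r s T (x, y)) _ s T);
    trivial.
  - intros y Hy. split; assumption.
  - apply dt_correct; [lra|trivial|split; simpl; lra].
Qed.

Lemma locally_interior (l r s T x t : R) :
  l < x < r -> s < t < T ->
  locally (x, t) (fun z : R * R => l < fst z < r /\ s < snd z < T).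
Proof.
  intros Hx Ht.
  assert (Hd : 0 < Rmin (Rmin (x - l) (r - x)) (Rmin (t - s) (T - t))).
  { repeat apply Rmin_pos; lra. }
  exists (mkposreal _ Hd). intros [y z] [Hy Hz]. simpl in Hy, Hz |- *.
  change (Rabs (y - x) < Rmin (Rmin (x - l) (r - x)) (Rmin (t - s) (T - t)))
    in Hy.
  change (Rabs (z - t) < Rmin (Rmin (x - l) (r - x)) (Rmin (t - s) (T - t)))
    in Hz.
  pose proof (Rmin_l (Rmin (x - l) (r - x)) (Rmin (t - s) (T - t))).
  pose proof (Rmin_r (Rmin (x - l) (r - x)) (Rmin (t - s) (T - t))).
  pose proof (Rmin_l (x - l) (r - x)). pose proof (Rmin_r (x - l) (r - x)).
  pose proof (Rmin_l (t - s) (T - t)). pose proof (Rmin_r (t - s) (T - t)).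
  apply Rabs_def2 in Hy. apply Rabs_def2 in Hz. lra.
Qed.

Lemma continuous_interior (l r s T x t : R) (f : R * R -> R) :
  continuous_on (cylinder l r s T) f -> l < x < r -> s < t < T ->
  continuous f (x, t).
Proof.
  intros Hf Hx Ht.
  apply (continuous_continuous_on (cylinder l r s T)); trivial.
  generalize (locally_interior l r s T x t Hx Ht).
  apply filter_imp. intros z Hz. split; lra.
Qed.

Lemma C1_differentiable (l r s T x t : R) (u : R * R -> R) :
  C1_on (cylinder l r s T) u -> l < x < r -> s < t < T ->
  differentiable_pt_lim (fun y z => u (y, z)) x t
    (dx (cylinder l r s T) u (x, t)) (dt (cylinder l r s T) u (x, t)).
Proof.
  intros H Hx Ht. apply filterdiff_differentiable_pt_lim.
  apply (is_derive_filterdiff (fun y z => u (y, z)) x t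
           (fun y z => dx (cylinder l r s T) u (y, z))).
  - generalize (locally_interior l r s T x t Hx Ht).
    apply filter_imp. intros [y z] [Hy Hz]. simpl in *.
    apply is_derive_dx; trivial; lra.
  - apply is_derive_dt; trivial; lra.
  - apply continuous_ext with (f := dx (cylinder l r s T) u).
    { intros [y z]. reflexivity. }
    apply (continuous_interior l r s T); trivial. apply H.
Qed.

(** Schwarz's theorem, after the relative derivatives have been identified with [Derive] near
    interior points. It cancels the cross terms in the derivative of a Riemann invariant. *)
Lemma C2_mixed (l r s T x t : R) (u : R * R -> R) :
  C2_on (cylinder l r s T) u -> l < x < r -> s < t < T ->
  dx (cylinder l r s T) (dt (cylinder l r s T) u) (x, t) =
  dt (cylinder l r s T) (dx (cylinder l r s T) u) (x, t).
Proof.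
  set (K := cylinder l r s T).
  intros [H [Hdx Hdt]] Hx Ht.
  set (f := fun y z => u (y, z)).
  assert (Dt : forall y z, l < y < r -> s < z < T ->
            Derive (fun t => f y t) z = dt K u (y, z)).
  { intros y z Hy Hz. apply is_derive_unique.
    apply is_derive_dt; trivial; lra. }
  assert (Dx : forall y z, l < y < r -> s < z < T ->
            Derive (fun t => f t z) y = dx K u (y, z)).
  { intros y z Hy Hz. apply is_derive_unique.
    apply is_derive_dx; trivial; lra. }
  assert (Dxt : forall y z, l < y < r -> s < z < T ->
            is_derive (fun y => Derive (fun t => f y t) z) y
              (dx K (dt K u) (y, z))).
  { intros y z Hy Hz.
    apply is_derive_ext_loc with (f := fun y => dt K u (y, z)).
    - generalize (locally_2d_1d_const_y (fun y z => l < y < r /\ s < z < T) y z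
        (proj2 (locally_2d_locally _ y z) (locally_interior l r s T y z Hy Hz))).
      apply filter_imp. intros w Hw. symmetry. now apply Dt.
    - apply is_derive_dx; trivial; lra. }
  assert (Dtx : forall y z, l < y < r -> s < z < T ->
            is_derive (fun z => Derive (fun t => f t z) y) z
              (dt K (dx K u) (y, z))).
  { intros y z Hy Hz.
    apply is_derive_ext_loc with (f := fun z => dx K u (y, z)).
    - generalize (locally_2d_1d_const_x (fun y z => l < y < r /\ s < z < T) y z
        (proj2 (locally_2d_locally _ y z) (locally_interior l r s T y z Hy Hz))).
      apply filter_imp. intros w Hw. symmetry. now apply Dx.
    - apply is_derive_dt; trivial; lra. }
  rewrite <- (is_derive_unique _ _ _ (Dxt x t Hx Ht)).
  rewrite <- (is_derive_unique _ _ _ (Dtx x t Hx Ht)).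
  assert (Hcont : forall F g, continuous_on K g ->
            (forall y z, l < y < r -> s < z < T -> F y z = g (y, z)) ->
            continuity_2d_pt F x t).
  { intros F g Hg HF. apply continuity_2d_pt_filterlim.
    change (continuous (fun z : R * R => F (fst z) (snd z)) (x, t)).
    apply continuous_ext_loc with (g := g).
    - generalize (locally_interior l r s T x t Hx Ht).
      apply filter_imp. intros [y z] [Hy Hz]. symmetry. now apply HF.
    - now apply (continuous_interior l r s T). }
  apply (Schwarz f x t).
  - apply locally_2d_locally.
    generalize (locally_interior l r s T x t Hx Ht).
    apply filter_imp. intros [y z] [Hy Hz]. simpl in *. repeat split.
    + exists (dx K u (y, z)). apply is_derive_dx; trivial; lra.
    + exists (dt K u (y, z)). apply is_derive_dt; trivial; lra.
    + exists (dx K (dt K u) (y, z)). now apply Dxt.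
    + exists (dt K (dx K u) (y, z)). now apply Dtx.
  - apply (Hcont _ (dx K (dt K u))); [apply Hdt|].
    intros y z Hy Hz. apply is_derive_unique. now apply Dxt.
  - apply (Hcont _ (dt K (dx K u))); [apply Hdx|].
    intros y z Hy Hz. apply is_derive_unique. now apply Dtx.
Qed.

Lemma classical_riemann_solution (c lam tau T l r : R) (u : R * R -> R) :
  0 < tau -> 0 < T -> l < r ->
  classical_solution c lam tau T l r u ->
  riemann_solution c lam tau T l r u
    (dt (cylinder l r 0 T) u) (dx (cylinder l r 0 T) u).
Proof.
  intros htau hT hlr H. set (K := cylinder l r 0 T).
  destruct (sol_C2 _ _ _ _ _ _ _ H) as [HC [Hdx Hdt]].
  split.
  - apply H.
  - apply HC.
  - apply HC.
  - intros x t Hx Ht. now apply is_derive_dt.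
  - intros e x t s He Hx Ht.
    pose proof (sol_equation _ _ _ _ _ _ _ H _ _ Hx Ht) as E. simpl in E.
    fold K in E.
    pose proof (C2_mixed l r 0 T _ _ u (sol_C2 _ _ _ _ _ _ _ H) Hx Ht) as Emix.
    fold K in Emix.
    assert (Hp : derivable_pt_lim (fun s => x + e * c * s) s (e * c)).
    { apply is_derive_Reals. auto_derive; [trivial|ring]. }
    assert (Hm : derivable_pt_lim (fun s => t - s) s (- 1)).
    { apply is_derive_Reals. auto_derive; [trivial|ring]. }
    (* By the chain rule the invariant has derivative [e c u_tx - u_tt + e^2 c^2 u_xx - e c u_xt].
       The mixed terms cancel and [e^2 = 1], which leaves [c^2 u_xx - u_tt], the negative of the
       delay term. *)
    pose proof (derivable_pt_lim_comp_2d _ _ _ s _ _ _ _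
      (C1_differentiable l r 0 T _ _ _ Hdt Hx Ht) Hp Hm) as D1.
    pose proof (derivable_pt_lim_comp_2d _ _ _ s _ _ _ _
      (C1_differentiable l r 0 T _ _ _ Hdx Hx Ht) Hp Hm) as D2.
    fold K in D1, D2. rewrite Emix in D1.
    apply is_derive_Reals in D1. apply is_derive_Reals in D2.
    apply (is_derive_scal _ _ 1) in D1. apply (is_derive_scal _ _ (e * c)) in D2.
    pose proof (is_derive_plus _ _ _ _ _ D1 D2) as D. clear D1 D2.
    refine (eq_ind _ (is_derive _ _) D _ _).
    assert (Hee : e * e = 1) by (destruct He; subst e; ring).
    change plus with Rplus. revert E.
    generalize (dt K (dx K u) (x + e * c * s, t - s)).
    generalize (dt K (dt K u) (x + e * c * s, t - s)).
    generalize (dx K (dx K u) (x + e * c * s, t - s)).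
    generalize (u (x + e * c * s, t - s - tau)).
    intros A1 A2 A3 A4 E.
    apply Rminus_diag_uniq.
    transitivity (- (A3 - (e * e) * c ^ 2 * A2) + lam * A1); [ring|].
    rewrite Hee. lra.
  - intros x Hx.
    assert (Hu : forall y t, l < y < r -> - tau <= t <= 0 -> u (y, t) = 0).
    { intros y t Hy Ht. now apply (sol_history _ _ _ _ _ _ _ H). }
    repeat split.
    (* The history prescribes the derivative 0 relative to [[-tau, T]]; restricted to [[0, T]] it
       must agree with the one-sided [dt] at time 0. *)
    + apply (is_derive_in_unique (fun s => 0 <= s <= T) (fun s => u (x, s))
               0 T 0); trivial; try lra.
      * apply is_derive_in_subset with (fun s => K (x, s)).
        { intros y Hy. split; simpl; lra. }
        apply dt_correct; trivial. split; simpl; lra.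
      * apply is_derive_in_subset with (fun s => - tau <= s <= T).
        { intros y Hy. lra. }
        apply (sol_history _ _ _ _ _ _ _ H); lra.
    + apply (is_derive_zero (fun y => u (y, 0)) l r x); trivial.
      * intros y Hy. apply Hu; lra.
      * apply is_derive_dx; trivial; lra.
    + intros t Ht. now apply Hu.
Qed.

(** * Superposition, reflection and comparison of solutions *)

Lemma riemann_solution_lin (c lam tau T l r m n : R)
  (u p q u' p' q' : R * R -> R) :
  riemann_solution c lam tau T l r u p q ->
  riemann_solution c lam tau T l r u' p' q' ->
  riemann_solution c lam tau T l r (fun z => m * u z + n * u' z)
    (fun z => m * p z + n * p' z) (fun z => m * q z + n * q' z).
Proof.
  intros [Hu Hp Hq Hd Hch Hi] [Hu' Hp' Hq' Hd' Hch' Hi'].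
  split; try (now apply continuous_on_lin).
  - intros x t Hx Ht.
    apply (is_derive_plus (fun s => m * u (x, s)) (fun s => n * u' (x, s)));
      apply is_derive_scal; auto.
  - intros e x t s He Hx Ht.
    pose proof (is_derive_plus _ _ _ _ _
      (is_derive_scal _ _ m _ (Hch e x t s He Hx Ht))
      (is_derive_scal _ _ n _ (Hch' e x t s He Hx Ht))) as D.
    refine (is_derive_ext _ _ _ _ _ (eq_ind _ (is_derive _ _) D _ _)).
    + intros y. change plus with Rplus. apply Rminus_diag_uniq. simpl. ring.
    + change plus with Rplus. apply Rminus_diag_uniq. simpl. ring.
  - intros x Hx. destruct (Hi x Hx) as [-> [-> E]].
    destruct (Hi' x Hx) as [-> [-> E']].
    repeat split; try ring. intros t Ht. rewrite E, E'; trivial. ring.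
Qed.

(** Under [x -> -x] the space derivative changes sign and the two families of characteristics, [e]
    and [- e], are exchanged. *)
Lemma riemann_solution_reflect (c lam tau T l r : R) (u p q : R * R -> R) :
  riemann_solution c lam tau T l r u p q ->
  riemann_solution c lam tau T (- r) (- l) (fun z => u (- fst z, snd z))
    (fun z => p (- fst z, snd z)) (fun z => - q (- fst z, snd z)).
Proof.
  intros [Hu Hp Hq Hd Hch Hi].
  assert (Hc : forall s (f : R * R -> R), continuous_on (cylinder l r s T) f ->
            continuous_on (cylinder (- r) (- l) s T)
              (fun z => f (- fst z, snd z))).
  { intros s f Hf.
    apply (continuous_on_comp _ (cylinder l r s T)
             (fun z : R * R => (- fst z, snd z)) f); trivial.
    - intros z [Hz Hz']. split; simpl; lra.
    - apply continuous_on_forall. intros z _.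
      apply (continuous_pair (fun z : R * R => - fst z) (fun z => snd z)).
      + apply (continuous_opp (fun z : R * R => fst z)), continuous_fst.
      + apply continuous_snd. }
  split; auto.
  - apply continuous_on_ext
      (* The negation is put in the two-term form of [continuous_on_lin]. *)
      with (fun z => 0 * q (- fst z, snd z) + - 1 * q (- fst z, snd z)).
    { intros z _. apply Rminus_diag_uniq. ring. }
    apply continuous_on_lin; auto.
  - intros x t Hx Ht. simpl. apply Hd; lra.
  - intros e x t s He Hx Ht. simpl.
    assert (E : forall s, - (x + e * c * s) = - x + - e * c * s)
      by (intros; ring).
    rewrite E.
    refine (is_derive_ext _ _ _ _ _ (Hch (- e) (- x) t s _ _ Ht)); [|lra..].
    intros y. rewrite E. apply Rminus_diag_uniq. simpl. ring.
  - intros x Hx. simpl. destruct (Hi (- x) ltac:(lra)) as [-> [-> E]].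
    repeat split; auto. ring.
Qed.

(** Uniqueness applied to [u - m w]. The factor [m = 2] compares corrections with errors, and
    [m = 0] shows that a solution with zero data vanishes. *)
Lemma classical_solution_unique (c lam tau T l r m : R) (u w : R * R -> R) :
  0 < c -> 0 < tau -> 0 < T -> l < r ->
  classical_solution c lam tau T l r u ->
  classical_solution c lam tau T l r w ->
  let K := cylinder l r 0 T in
  (forall t, 0 < t < T -> u (l, t) = m * w (l, t)) \/
  (forall t, 0 < t < T -> dx K u (l, t) = m * dx K w (l, t)) ->
  (forall t, 0 < t < T -> u (r, t) = m * w (r, t)) \/
  (forall t, 0 < t < T -> dx K u (r, t) = m * dx K w (r, t)) ->
  forall x t, cylinder l r (- tau) T (x, t) -> u (x, t) = m * w (x, t).
Proof.
  intros hc htau hT hlr Hu Hw K Hl Hr x t Hxt.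
  assert (E : 1 * u (x, t) + - m * w (x, t) = 0); [|lra].
  pose proof (riemann_solution_lin _ _ _ _ _ _ 1 (- m) _ _ _ _ _ _
    (classical_riemann_solution _ _ _ _ _ _ _ htau hT hlr Hu)
    (classical_riemann_solution _ _ _ _ _ _ _ htau hT hlr Hw)) as S.
  apply (riemann_solution_zero _ _ _ _ _ _ _ _ _ hc htau hT hlr S); trivial.
  - destruct Hl as [H|H]; [left|right]; intros s Hs; cbv beta; fold K; rewrite (H s Hs); ring.
  - destruct Hr as [H|H]; [left|right]; intros s Hs; cbv beta; fold K; rewrite (H s Hs); ring.
Qed.

(** The reflection of [e1] minus [e2] has zero Dirichlet data on [(0, a)], so its space derivative
    vanishes up to the interface; the reflection accounts for the sign. *)
Lemma interface_flux_opposite (a c lam tau T : R) (e1 e2 : R * R -> R) :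
  0 < a -> 0 < c -> 0 < tau -> 0 < T ->
  classical_solution c lam tau T (- a) 0 e1 ->
  classical_solution c lam tau T 0 a e2 ->
  (forall t, 0 < t < T -> e1 (- a, t) = e2 (a, t)) ->
  (forall t, 0 < t < T -> e1 (0, t) = e2 (0, t)) ->
  forall t, 0 < t < T ->
  dx (cylinder (- a) 0 0 T) e1 (0, t) = - dx (cylinder 0 a 0 T) e2 (0, t).
Proof.
  intros ha hc htau hT He1 He2 Houter Hinter t Ht.
  assert (ha' : - a < 0) by lra.
  pose proof (riemann_solution_reflect _ _ _ _ _ _ _ _ _
    (classical_riemann_solution _ _ _ _ _ _ _ htau hT ha' He1)) as S1.
  rewrite Ropp_0, Ropp_involutive in S1.
  pose proof (riemann_solution_lin _ _ _ _ _ _ 1 (- 1) _ _ _ _ _ _ S1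
    (classical_riemann_solution _ _ _ _ _ _ _ htau hT ha He2)) as S2.
  destruct (riemann_solution_zero _ _ _ _ _ _ _ _ _ hc htau hT ha S2)
    as [_ H].
  - left. intros s Hs. simpl. rewrite Ropp_0, (Hinter s Hs). ring.
  - left. intros s Hs. simpl. rewrite (Houter s Hs). ring.
  - specialize (H 0 t). simpl in H. rewrite Ropp_0 in H.
    assert (HK : cylinder 0 a 0 T (0, t)) by (split; simpl; lra).
    specialize (H HK). lra.
Qed.

(** The interface conditions hold for [0 < t < T] only, whereas the iterates are compared on
    [[0, T]]. The cylinder lemma is reused with a dummy space variable. *)
Lemma continuous_on_eq_closed (T : R) (f g : R -> R) :
  0 < T ->
  continuous_on (fun t => 0 <= t <= T) f ->
  continuous_on (fun t => 0 <= t <= T) g ->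
  (forall t, 0 < t < T -> f t = g t) ->
  forall t, 0 <= t <= T -> f t = g t.
Proof.
  intros hT Hf Hg H t Ht.
  assert (E : 1 * f t + - 1 * g t = 0); [|lra].
  apply (continuous_on_eq0_cylinder (cylinder 0 1 0 T)
           (fun z => 1 * f (snd z) + - 1 * g (snd z)) 0 1 0 T) with (x := 0);
    trivial; try lra.
  - apply continuous_on_lin;
      apply (continuous_on_comp _ (fun t => 0 <= t <= T)
               (fun z : R * R => snd z)); trivial;
      try (intros z Hz; apply Hz);
      apply continuous_on_forall; intros z _; apply continuous_snd.
  - intros x s _ Hs. simpl. rewrite (H s Hs). ring.
Qed.

Lemma continuous_on_trace (l r s T x : R) (u : R * R -> R) :
  s <= 0 -> l <= x <= r -> continuous_on (cylinder l r s T) u ->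
  continuous_on (fun t => 0 <= t <= T) (fun t => u (x, t)).
Proof.
  intros Hs Hx Hu.
  apply (continuous_on_comp _ (cylinder l r s T) (fun t => (x, t)) u); trivial.
  - intros t Ht. split; simpl; lra.
  - apply continuous_on_forall. intros t _.
    apply (continuous_pair (fun _ => x) (fun t => t));
      [apply continuous_const|apply continuous_id].
Qed.

(** * The iteration on equal subdomains *)

Section Iteration.

Variables (a c lam tau T theta : R) (g0 : R -> R) (I : iterates).
Hypotheses (ha : 0 < a) (hc : 0 < c) (htau : 0 < tau) (hT : 0 < T).
Hypothesis HI : NNWR a a c lam tau T theta g0 I.

(** The fluxes being opposite, the jump equals twice the flux of [ie1] and minus twice that of
    [ie2]. So each correction shares its Neumann datum, and its zero outer datum, with twice the
    error. *)
Lemma NNWR_correction (k : nat) (x t : R) :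
  (1 <= k)%nat ->
  (cylinder (- a) 0 (- tau) T (x, t) -> iphi1 I k (x, t) = 2 * ie1 I k (x, t)) /\
  (cylinder 0 a (- tau) T (x, t) -> iphi2 I k (x, t) = 2 * ie2 I k (x, t)).
Proof.
  intros Hk.
  pose proof (nnwr_e1 _ _ _ _ _ _ _ _ _ HI k Hk) as He1.
  pose proof (nnwr_e2 _ _ _ _ _ _ _ _ _ HI k Hk) as He2.
  pose proof (fun t => nnwr_outer _ _ _ _ _ _ _ _ _ HI k t Hk) as Ho.
  assert (Hflux : forall s, 0 < s < T ->
    dx (cylinder (- a) 0 0 T) (ie1 I k) (0, s) =
    - dx (cylinder 0 a 0 T) (ie2 I k) (0, s)).
  { apply (interface_flux_opposite a c lam tau T); trivial.
    - intros s Hs. destruct (Ho s Hs) as [-> [-> _]]. reflexivity.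
    - intros s Hs.
      destruct (nnwr_dirichlet _ _ _ _ _ _ _ _ _ HI k s Hk Hs) as [-> ->].
      reflexivity. }
  split.
  - apply (classical_solution_unique c lam tau T); trivial; try lra.
    + now apply (nnwr_phi1 _ _ _ _ _ _ _ _ _ HI).
    + left. intros s Hs. destruct (Ho s Hs) as [-> [_ [-> _]]]. ring.
    + right. intros s Hs.
      destruct (nnwr_neumann _ _ _ _ _ _ _ _ _ HI k s Hk Hs) as [H _].
      rewrite H. pose proof (Hflux s Hs). lra.
  - apply (classical_solution_unique c lam tau T); trivial.
    + now apply (nnwr_phi2 _ _ _ _ _ _ _ _ _ HI).
    + right. intros s Hs.
      destruct (nnwr_neumann _ _ _ _ _ _ _ _ _ HI k s Hk Hs) as [_ H].
      pose proof (Hflux s Hs). lra.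
    + left. intros s Hs. destruct (Ho s Hs) as [_ [-> [_ ->]]]. ring.
Qed.

(** On the interface the two corrections add up to four times the previous interface error.
    Continuity of [ig I k] carries the Dirichlet condition to the times 0 and [T]. *)
Lemma NNWR_contraction (k : nat) (t : R) :
  continuous_on (fun t => 0 <= t <= T) (ig I k) -> 0 <= t <= T ->
  ig I (S k) t = (1 - 4 * theta) * ig I k t.
Proof.
  intros Hg Ht.
  assert (Hk : (1 <= S k)%nat) by lia.
  assert (Hd := fun s => nnwr_dirichlet _ _ _ _ _ _ _ _ _ HI (S k) s Hk).
  rewrite (nnwr_update _ _ _ _ _ _ _ _ _ HI (S k) t Hk Ht).
  replace (S k - 1)%nat with k in * by lia.
  destruct (NNWR_correction (S k) 0 t Hk) as [E1 E2].
  rewrite E1, E2 by (split; simpl; lra).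
  assert (T1 : ie1 I (S k) (0, t) = ig I k t).
  { apply (continuous_on_eq_closed T (fun s => ie1 I (S k) (0, s))); trivial.
    - apply (continuous_on_trace (- a) 0 (- tau)); try lra.
      apply (nnwr_e1 _ _ _ _ _ _ _ _ _ HI _ Hk).
    - intros s Hs. now apply Hd. }
  assert (T2 : ie2 I (S k) (0, t) = ig I k t).
  { apply (continuous_on_eq_closed T (fun s => ie2 I (S k) (0, s))); trivial.
    - apply (continuous_on_trace 0 a (- tau)); try lra.
      apply (nnwr_e2 _ _ _ _ _ _ _ _ _ HI _ Hk).
    - intros s Hs. now apply Hd. }
  rewrite T1, T2. ring.
Qed.

Hypothesis Hg0 : continuous_on (fun t => 0 <= t <= T) g0.

Lemma NNWR_geometric (k : nat) (t : R) :
  0 <= t <= T -> ig I k t = (1 - 4 * theta) ^ k * g0 t.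
Proof.
  revert t. induction k as [|k IH]; intros t Ht.
  - simpl. rewrite Rmult_1_l. now apply (nnwr_init _ _ _ _ _ _ _ _ _ HI).
  - rewrite NNWR_contraction; trivial.
    + rewrite IH by trivial. simpl. ring.
    (* The induction hypothesis makes [ig I k] a multiple of [g0], hence continuous as the
       contraction requires. *)
    + apply continuous_on_ext
        with (fun t => (1 - 4 * theta) ^ k * g0 t + 0 * g0 t).
      { intros s Hs. rewrite (IH s Hs). apply Rminus_diag_uniq. ring. }
      now apply continuous_on_lin.
Qed.

Lemma NNWR_error_zero (k : nat) (x t : R) :
  (1 <= k)%nat -> (forall t, 0 <= t <= T -> ig I (k - 1) t = 0) ->
  (cylinder (- a) 0 (- tau) T (x, t) -> ie1 I k (x, t) = 0) /\
  (cylinder 0 a (- tau) T (x, t) -> ie2 I k (x, t) = 0).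
Proof.
  intros Hk Hz.
  pose proof (fun t => nnwr_outer _ _ _ _ _ _ _ _ _ HI k t Hk) as Ho.
  pose proof (fun t => nnwr_dirichlet _ _ _ _ _ _ _ _ _ HI k t Hk) as Hd.
  split; intros Hxt.
  - rewrite <- (Rmult_0_l (ie1 I k (x, t))).
    apply (classical_solution_unique c lam tau T (- a) 0); trivial; try lra;
      try (now apply (nnwr_e1 _ _ _ _ _ _ _ _ _ HI));
      left; intros s Hs; rewrite Rmult_0_l.
    + now apply Ho.
    + rewrite (proj1 (Hd s Hs)). apply Hz. lra.
  - rewrite <- (Rmult_0_l (ie2 I k (x, t))).
    apply (classical_solution_unique c lam tau T 0 a); trivial;
      try (now apply (nnwr_e2 _ _ _ _ _ _ _ _ _ HI));
      left; intros s Hs; rewrite Rmult_0_l.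
    + rewrite (proj2 (Hd s Hs)). apply Hz. lra.
    + now apply Ho.
Qed.

End Iteration.

(** * Sup norms and the two convergence statements *)

Lemma sup_norm_attained (T t0 : R) (g : R -> R) :
  0 <= t0 <= T -> (forall t, 0 <= t <= T -> Rabs (g t) <= Rabs (g t0)) ->
  sup_norm T g = Rabs (g t0).
Proof.
  intros Ht0 Hmax. unfold sup_norm.
  (* The supremum is finite, so [real] does not return its default value. *)
  rewrite (is_lub_Rbar_unique _ (Rabs (g t0))); [reflexivity|]. split.
  - intros y [t [Ht ->]]. now apply Hmax.
  - intros b Hb. apply Hb. now exists t0.
Qed.

Lemma continuous_on_abs_max (T : R) (g : R -> R) :
  0 <= T -> continuous_on (fun t => 0 <= t <= T) g ->
  exists t0, 0 <= t0 <= T /\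
    forall t, 0 <= t <= T -> Rabs (g t) <= Rabs (g t0).
Proof.
  intros hT Hg.
  destruct (continuity_ab_maj (fun s => Rabs (g (Rmax 0 (Rmin T s)))) 0 T hT)
    as [t0 [Hmax Ht0]].
  - intros s _.
    apply (continuity_pt_comp (fun s => g (Rmax 0 (Rmin T s))) Rabs).
    + now apply clamp_continuous.
    + apply Rcontinuity_abs.
  - exists t0. split; [exact Ht0|]. intros t Ht.
    generalize (Hmax t Ht). rewrite !Rmin_right, !Rmax_right by lra. trivial.
Qed.

Theorem theorem4 (tau c lam T a b theta : R)
  (htau : 0 < tau) (hc : 0 < c) (hT : 0 < T) (ha : 0 < a) (hb : 0 < b)
  (hab : a = b) :
  (0 < theta < 1 / 2 -> theta <> 1 / 4 ->
     converges_linearly a b c lam tau T theta) /\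
  (theta = 1 / 4 ->
     converges_in_two_iterations a b c lam tau T theta).
Proof.
  subst b. split.
  - intros Htheta Hne g0 [Hg0 _] [s [Hs Hgs]].
    (* Excluding [theta = 1 / 4] keeps every iterate nonzero and the limit ratio positive. *)
    assert (Hq : 1 - 4 * theta <> 0) by lra.
    exists (Rabs (1 - 4 * theta)). split.
    { split; [now apply Rabs_pos_lt|]. apply Rabs_def1; lra. }
    intros I HI.
    pose proof (fun k t => NNWR_geometric a c lam tau T theta g0 I
                  ha hc htau hT HI Hg0 k t) as Hgeo.
    split.
    + intros k. exists s. split; [exact Hs|]. rewrite Hgeo by exact Hs.
      apply Rmult_integral_contrapositive_currified; [|exact Hgs].
      now apply pow_nonzero.
    (* All iterates are multiples of [g0], so one point [t0] realises all their norms and the ratio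
       of successive norms is constant. *)
    + destruct (continuous_on_abs_max T g0 ltac:(lra) Hg0) as [t0 [Ht0 Hmax]].
      assert (Hpos : 0 < Rabs (g0 t0)).
      { apply Rlt_le_trans with (Rabs (g0 s)); [now apply Rabs_pos_lt|].
        now apply Hmax. }
      assert (Hsup : forall k, sup_norm T (ig I k) =
                Rabs (1 - 4 * theta) ^ k * Rabs (g0 t0)).
      { intros k. rewrite (sup_norm_attained T t0); trivial.
        - rewrite Hgeo, Rabs_mult, RPow_abs by exact Ht0. reflexivity.
        - intros t Ht. rewrite !Hgeo, !Rabs_mult by assumption.
          apply Rmult_le_compat_l; [apply Rabs_pos|now apply Hmax]. }
      apply is_lim_seq_ext with (fun _ => Rabs (1 - 4 * theta));
        [|apply is_lim_seq_const].
      intros k. rewrite !Hsup. simpl. field. split; [lra|].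
      now apply pow_nonzero, Rabs_no_R0.
  - intros -> g0 [Hg0 _] I HI k Hk.
    (* The contraction factor is now 0, so the interface error vanishes from index 1 on. The
       subdomain errors follow one index later, since their Dirichlet datum at [k] is the interface
       error at [k - 1]. *)
    assert (Hz : forall j t, (1 <= j)%nat -> 0 <= t <= T -> ig I j t = 0).
    { intros j t Hj Ht.
      rewrite (NNWR_geometric a c lam tau T (1 / 4) g0 I) by trivial.
      replace (1 - 4 * (1 / 4)) with 0 by field.
      rewrite pow_i by lia. ring. }
    assert (He := fun x t => NNWR_error_zero a c lam tau T (1 / 4) g0 I
      ha hc htau hT HI k x t ltac:(lia)
      (fun t Ht => Hz (k - 1)%nat t ltac:(lia) Ht)).
    repeat split.
    + intros [x t] Hp. now apply He.
    + intros [x t] Hp. now apply He.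
    + intros t Ht. apply Hz; [lia|exact Ht].
Qed.
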